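(* Let $m\in\mathbb{N}_+$. If $\tilde w\in\mathbb{O}_{2m,\delta}$ and $\ell(\tilde w)=2m+2k$ with $k\in\mathbb{N}$, then $$f_{\tilde w,\mathbb{O}}=\begin{cases}(k-j)(v-v^{-1})^2,&\mathbb{O}=\mathbb{O}_{2m+2j,\delta}\ (1\leq j\leq k-1),\\ k(v-v^{-1})^2+1,&\mathbb{O}=\mathbb{O}_{2m,\delta},\\ k(v-v^{-1})^2,&\mathbb{O}=\mathbb{O}_{2m-2j,\delta}\ (1\leq j\leq m-1),\\ k(v-v^{-1}),&\mathbb{O}=\mathbb{O}_{1,\delta},\\ 0,&\text{otherwise.}\end{cases}$$
   Context: $W=\langle s_1,s_2\rangle$ is the finite Weyl group of type $A_2$; $\alpha_1,\alpha_2$ are the simple roots, identified with the simple coroots ($\langle\alpha_i,\alpha_i\rangle=2$, $\langle\alpha_1,\alpha_2\rangle=-1$); $Q=\mathbb{Z}\alpha_1\oplus\mathbb{Z}\alpha_2$; $P$ is the coweight lattice; $\widetilde W=P\rtimes W$ with translations $t^\lambda$. $W_a=Q\rtimes W$ is the Coxeter group generated by $s_0=t^{\alpha_1+\alpha_2}s_1s_2s_1$, $s_1$, $s_2$; $\widetilde W=W_a\rtimes\langle\tau\rangle$ with $\tau^3=1$, $\tau s_0\tau^{-1}=s_1$, $\tau s_1\tau^{-1}=s_2$, $\tau s_2\tau^{-1}=s_0$; $\ell(w\tau^j)=\ell(w)$ for $w\in W_a$. $\delta$ is the automorphism of $\widetilde W$ fixing $s_0$ and interchanging $s_1$ and $s_2$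 (so $\delta(\tau)=\tau^{-1}$). $\tilde w,\tilde w'$ are $\delta$-conjugate if $\tilde w'=\tilde x\tilde w\delta(\tilde x)^{-1}$ for some $\tilde x\in\widetilde W$. $\mathbb{N}$ contains $0$; $\mathbb{N}_+=\mathbb{N}\setminus\{0\}$. Class polynomials: $\widetilde H$ is the algebra over $\mathbb{Z}[v,v^{-1}]$ with basis $T_{\tilde w}$ ($\tilde w\in\widetilde W$), $T_{\tilde x}T_{\tilde y}=T_{\tilde x\tilde y}$ if $\ell(\tilde x)+\ell(\tilde y)=\ell(\tilde x\tilde y)$, and $(T_s-v)(T_s+v^{-1})=0$ for $s\in\{s_0,s_1,s_2\}$; $\delta$ acts on $\widetilde H$ by $T_{\tilde w}\mapsto T_{\delta(\tilde w)}$. $[\widetilde H,\widetilde H]_\delta$ is the submodule spanned by all $hh'-h'\delta(h)$. For a $\delta$-conjugacy class $\mathbb{O}$, $T_{\mathbb{O}}$ is the image in $\widetilde H/[\widetilde H,\widetilde H]_\delta$ of $T_w$ for any minimal length $w\in\mathbb{O}$; by He–Nie this is well defined and the $T_{\mathbb{O}}$ form a basis. The class polynomials $f_{\tilde w,\mathbb{O}}$ are the unique coefficients with $T_{\tilde w}\equiv\sum_{\mathbb{O}}f_{\tilde w,\mathbb{O}}T_{\mathbb{O}}\bmod[\widetilde H,\widetilde H]_\delta$. For $X\subset W_a$ put $\widehat X=X\sqcup\{(\tau x\tau^{-1})\tau^2\mid x\in X\}\sqcup\{(\tau^2x\tau^{-2})\tau\mid x\in X\}$. $\delta$-conjugacy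 classes: $\mathbb{O}_{1,\delta}=\widehat X$ for $X=\{t^\lambda s_1,\ t^\lambda s_2\mid\lambda\in Q\}$; for $m\in\mathbb{N}_+$, with $\epsilon(m)=1$ if $m$ is odd and $0$ if $m$ is even, $\mathbb{O}_{2m,\delta}=\widehat X_m$, where $X_m$ consists of the elements, for all $k\in\mathbb{Z}$, $t^{(k-\lfloor m/2\rfloor)\alpha_1+(2k+\epsilon(m))\alpha_2}s_2s_1$, $t^{(k+\lfloor (m+1)/2\rfloor)\alpha_1+(2k+\epsilon(m))\alpha_2}s_2s_1$, $t^{(2k+\epsilon(m))\alpha_1+(k+\lfloor (m+1)/2\rfloor)\alpha_2}s_1s_2$, $t^{(2k+\epsilon(m))\alpha_1+(k-\lfloor m/2\rfloor)\alpha_2}s_1s_2$, $t^{k\alpha_1+(m-k)\alpha_2}$, $t^{(k-m)\alpha_1-k\alpha_2}$. *)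

(* Defs.v *)
From HB Require Import structures.
From mathcomp Require Import all_boot all_order all_fingroup all_algebra.
From mathcomp Require Import mathcomp_extra boolp classical_sets functions.
From mathcomp Require Import cardinality fsbigop.
From mathcomp Require Import ring.

Set Implicit Arguments.
Unset Strict Implicit.
Unset Printing Implicit Defensive.

Import GRing.Theory.
Local Open Scope ring_scope.
Local Open Scope group_scope.
Local Open Scope classical_set_scope.

(* Z[v, v^-1], realized as the subring { p / v^n } of the fraction field of
   Z[v]. *)

Definition laurent_pred : {pred {fraction {poly int}}} :=
  fun x => `[< exists (p : {poly int}) (n : nat),
                 x = (tofrac p / tofrac 'X ^+ n)%R >].

Lemma tofracX_neq0 : (tofrac ('X : {poly int}) != 0)%R.
Proof. by rewrite tofrac_eq0 polyX_eq0. Qed.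

Lemma laurent_subring : subring_closed laurent_pred.
Proof.
have X0 n : (tofrac ('X : {poly int}) ^+ n != 0)%R.
  by rewrite expf_neq0 // tofracX_neq0.
split.
- by apply/asboolP; exists 1%R, 0%N; rewrite tofrac1 expr0 divr1.
- move=> x y /asboolP[p [n ->]] /asboolP[q [k ->]]; apply/asboolP.
  exists (p * 'X^k - q * 'X^n)%R, (n + k)%N.
  by rewrite -mulNr addf_div // exprD tofracB !tofracM !tofracXn mulNr.
- move=> x y /asboolP[p [n ->]] /asboolP[q [k ->]]; apply/asboolP.
  exists (p * q)%R, (n + k)%N.
  by rewrite mulf_div exprD tofracM.
Qed.

HB.instance Definition _ := GRing.isSubringClosed.Build
  {fraction {poly int}} laurent_pred laurent_subring.

Record laurent := Laurent {
  laurent_val : {fraction {poly int}};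
  laurent_valP : laurent_val \in laurent_pred }.

HB.instance Definition _ := [isSub for laurent_val].
HB.instance Definition _ := [Choice of laurent by <:].
HB.instance Definition _ := [SubChoice_isSubComNzRing of laurent by <:].

Lemma laurent_predX : tofrac 'X \in laurent_pred.
Proof. by apply/asboolP; exists 'X%R, 0%N; rewrite expr0 divr1. Qed.

Lemma laurent_predXV : (tofrac 'X)^-1%R \in laurent_pred.
Proof. by apply/asboolP; exists 1%R, 1%N; rewrite tofrac1 div1r expr1. Qed.

Definition vv : laurent := Laurent laurent_predX.
Definition vvV : laurent := Laurent laurent_predXV.

Lemma mulvvV : (vv * vvV = 1)%R.
Proof. by apply: val_inj; apply: divff; apply: tofracX_neq0. Qed.

(* The coweight lattice P, each lambda in P being given by its pairings
   (<lambda, alpha_1>, <lambda, alpha_2>), that is, by its coordinates on the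
   fundamental coweights. *)
Definition coweight := (int * int)%type.
HB.instance Definition _ := GRing.Zmodule.on coweight.

Definition alpha1 : coweight := (2, -1)%R.
Definition alpha2 : coweight := (-1, 2)%R.

(* The model of P in Z^3 / Z(1,1,1) where alpha_1 = e_0 - e_1 and
   alpha_2 = e_1 - e_2; the finite Weyl group W = 'S_3 permutes coordinates.
   Since (u * w) i = w (u i) in 'S_3, this is a left action (wactM). *)
Definition coord (l : coweight) (i : 'I_3) : int :=
  nth 0%R [:: l.1 + l.2; l.2; 0]%R i.

Definition i0 : 'I_3 := @Ordinal 3 0 isT.
Definition i1 : 'I_3 := @Ordinal 3 1 isT.
Definition i2 : 'I_3 := @Ordinal 3 2 isT.

Definition wact (w : 'S_3) (l : coweight) : coweight :=
  (coord l (w i0) - coord l (w i1), coord l (w i1) - coord l (w i2))%R.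

Lemma ord3P (i : 'I_3) : [\/ i = i0, i = i1 | i = i2].
Proof.
case: i => [[|[|[|i]]] h] //.
- by constructor 1; apply: val_inj.
- by constructor 2; apply: val_inj.
- by constructor 3; apply: val_inj.
Qed.

Lemma coord_wact w l i j :
  (coord (wact w l) i - coord (wact w l) j = coord l (w i) - coord l (w j))%R.
Proof.
by case: (ord3P i) => ->; case: (ord3P j) => ->; rewrite /coord /=; ring.
Qed.

Lemma wactM u w l : wact (u * w) l = wact u (wact w l).
Proof. by rewrite {1 2}/wact !coord_wact !permM. Qed.

Lemma wact1 l : wact 1 l = l.
Proof. by case: l => a b; rewrite /wact !perm1 /coord /=; congr pair; ring. Qed.

Lemma coordB l m i : (coord (l - m) i = coord l i - coord m i)%R.
Proof.
by case: l m (ord3P i) => [a b] [c d] [] ->; rewrite /coord /=; ring.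
Qed.

Lemma wact_is_zmod_morphism w : zmod_morphism (wact w).
Proof.
move=> l m; rewrite /wact !coordB; congr pair;
  by rewrite /= !opprD !opprK addrACA.
Qed.

HB.instance Definition _ w := GRing.isZmodMorphism.Build coweight coweight
  (wact w) (wact_is_zmod_morphism w).

(* The extended affine Weyl group P ><| W; ExtWeyl l w is t^l w. *)
Record ext_weyl := ExtWeyl { tpart : coweight; wpart : 'S_3 }.

Lemma ext_weylK :
  cancel (fun x => (tpart x, wpart x)) (fun p => ExtWeyl p.1 p.2).
Proof. by case. Qed.

HB.instance Definition _ := Choice.copy ext_weyl (can_type ext_weylK).

Definition ew_mul x y :=
  ExtWeyl (tpart x + wact (wpart x) (tpart y))%R (wpart x * wpart y).
Definition ew_one := ExtWeyl 0%R 1.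
Definition ew_inv x :=
  ExtWeyl (- wact (wpart x)^-1 (tpart x))%R (wpart x)^-1.

Lemma ew_mulA : associative ew_mul.
Proof.
case=> [l u] [m w] [n z].
by rewrite /ew_mul /= raddfD /= wactM addrA mulgA.
Qed.

Lemma ew_mul1 : left_id ew_one ew_mul.
Proof. by case=> l u; rewrite /ew_mul /= wact1 add0r mul1g. Qed.

Lemma ew_mulr1 : right_id ew_one ew_mul.
Proof. by case=> l u; rewrite /ew_mul /= raddf0 addr0 mulg1. Qed.

Lemma ew_mulV : left_inverse ew_one ew_inv ew_mul.
Proof. by case=> l u; rewrite /ew_mul /ew_inv /= addNr mulVg. Qed.

Lemma ew_mulrV : right_inverse ew_one ew_inv ew_mul.
Proof.
by case=> l u; rewrite /ew_mul /ew_inv /= raddfN /= -wactM mulgV wact1 subrr.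
Qed.

HB.instance Definition _ := isGroup.Build ext_weyl
  ew_mulA ew_mul1 ew_mulr1 ew_mulV ew_mulrV.

Definition transl (l : coweight) : ext_weyl := ExtWeyl l 1.
Definition tQ (a b : int) : ext_weyl := transl (alpha1 *~ a + alpha2 *~ b)%R.
Arguments tQ (a b)%_R.

Definition s1 : ext_weyl := ExtWeyl 0%R (tperm i0 i1).
Definition s2 : ext_weyl := ExtWeyl 0%R (tperm i1 i2).
Definition s0 : ext_weyl := tQ 1 1 * (s1 * s2 * s1).

Definition simple (i : 'I_3) : ext_weyl := nth 1 [:: s0; s1; s2] i.

(* tau = t^(omega_1) s_1 s_2, omega_1 being the first fundamental coweight;
   its defining relations are tau_s0, tau_s1, tau_s2 and tau3 below. *)
Definition tau : ext_weyl := transl (1, 0)%R * (s1 * s2).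

(* The diagram automorphism fixing s_0 and swapping s_1 and s_2: on P it
   swaps the fundamental coweights, and on W = 'S_3 it is conjugation by the
   longest element tperm i0 i2. *)
Definition delta (x : ext_weyl) : ext_weyl :=
  ExtWeyl ((tpart x).2, (tpart x).1) (wpart x ^ tperm i0 i2).

Lemma perm3P (u w : 'S_3) : u i0 = w i0 -> u i1 = w i1 -> u = w.
Proof.
move=> e0 e1; apply/permP => i; case: (ord3P i) => -> //.
have h (x : 'S_3) : x i2 != x i0 /\ x i2 != x i1.
  by split; apply/eqP => /perm_inj.
move: (h u) (h w); rewrite e0 e1 => -[a b] [c d].
have : w i0 != w i1 by apply/eqP => /perm_inj.
by move: a b c d; case: (ord3P (u i2)) => ->; case: (ord3P (w i2)) => ->;
   case: (ord3P (w i0)) => ->; case: (ord3P (w i1)) => ->.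
Qed.

Lemma wconjE (u : 'S_3) i :
  (u ^ tperm i0 i2) i = tperm i0 i2 (u (tperm i0 i2 i)).
Proof. by rewrite conjgE tpermV !permM. Qed.

Lemma coord_flip c d i :
  coord (d, c) (tperm i0 i2 i) = (c + d - coord (c, d) i)%R.
Proof.
by case: (ord3P i) => ->; rewrite ?tpermL ?tpermR ?tpermD // /coord /=; ring.
Qed.

Lemma delta_morph : {morph delta : x y / x * y}.
Proof.
case=> [[a b] u] [[c d] w].
suff E : (coord (c, d) (u i1) - coord (c, d) (u i2),
          coord (c, d) (u i0) - coord (c, d) (u i1))%R =
         wact (u ^ tperm i0 i2) (d, c).
  by congr ExtWeyl; [rewrite -E | rewrite conjMg].
rewrite /wact !wconjE !coord_flip tpermL tpermR tpermD //.
by congr pair; ring.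
Qed.

Lemma mulE l u m w :
  ExtWeyl l u * ExtWeyl m w = ExtWeyl (l + wact u m)%R (u * w).
Proof. by []. Qed.

Lemma wact_s1 l : wact (tperm i0 i1) l = (- l.1, l.1 + l.2)%R.
Proof. by rewrite /wact tpermL tpermR tpermD // /coord /=; congr pair; ring. Qed.

Lemma wact_s2 l : wact (tperm i1 i2) l = (l.1 + l.2, - l.2)%R.
Proof. by rewrite /wact tpermL tpermR tpermD // /coord /=; congr pair; ring. Qed.

Lemma tperm3E (i j k : 'I_3) :
  tperm i j k = if k == i then j else if k == j then i else k.
Proof.
case: tpermP => [-> | -> | /eqP/negPf-> /eqP/negPf->] //; rewrite eqxx //.
by case: eqP.
Qed.

Ltac perm3 := by apply: perm3P; rewrite ?(permM, wconjE, perm1) !tperm3E.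

Lemma s1s2s1E : tperm i0 i1 * tperm i1 i2 * tperm i0 i1 = tperm i0 i2 :> 'S_3.
Proof. perm3. Qed.

Lemma delta_s1 : delta s1 = s2.
Proof. by congr ExtWeyl; perm3. Qed.

Lemma delta_s2 : delta s2 = s1.
Proof. by congr ExtWeyl; perm3. Qed.

Lemma s0E : s0 = ExtWeyl (1, 1)%R (tperm i0 i2).
Proof. by rewrite /s0 !mulE !raddf0 !addr0 s1s2s1E mul1g. Qed.

Lemma delta_s0 : delta s0 = s0.
Proof. by rewrite s0E; congr ExtWeyl; perm3. Qed.

Lemma tauE : tau = ExtWeyl (1, 0)%R (tperm i0 i1 * tperm i1 i2).
Proof. by rewrite /tau !mulE !raddf0 !addr0 mul1g. Qed.

Ltac ew_compute :=
  rewrite ?mulE ?raddf0 -?s1s2s1E ?wactM ?(wact_s1, wact_s2);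
  congr ExtWeyl; perm3.

Lemma tau3 : tau ^+ 3 = 1.
Proof.
rewrite !expgS expg0 mulg1 tauE -[RHS]/(ExtWeyl 0%R 1); ew_compute.
Qed.

Lemma tau_s0 : tau * s0 * tau^-1 = s1.
Proof. apply: (canLR (mulgK _)); rewrite s0E tauE; ew_compute. Qed.

Lemma tau_s1 : tau * s1 * tau^-1 = s2.
Proof. apply: (canLR (mulgK _)); rewrite tauE; ew_compute. Qed.

Lemma tau_s2 : tau * s2 * tau^-1 = s0.
Proof. apply: (canLR (mulgK _)); rewrite s0E tauE; ew_compute. Qed.

Lemma delta_tau : delta tau = tau^-1.
Proof.
have E : delta tau = ExtWeyl (0, 1)%R (tperm i1 i2 * tperm i0 i1).
  by rewrite tauE; congr ExtWeyl; perm3.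
apply: (mulIg tau); rewrite mulVg E tauE -[RHS]/(ExtWeyl 0%R 1); ew_compute.
Qed.

Definition has_word (x : ext_weyl) (n : nat) : Prop :=
  exists (r : seq 'I_3) (j : nat),
    size r = n /\ x = (\prod_(i <- r) simple i) * tau ^+ j.

(* The length: as W~ = W_a ><| <tau>, the element w tau^j with w in W_a has
   length the least size of a word in s_0, s_1, s_2 with product w. *)
Definition len (x : ext_weyl) : nat :=
  xget 0%N [set n | has_word x n /\ forall k, has_word x k -> (n <= k)%N].

Definition dconj (x y : ext_weyl) : Prop :=
  exists z : ext_weyl, y = z * x * (delta z)^-1.

Definition dclasses : set (set ext_weyl) :=
  [set O | exists x, O = [set y | dconj x y]].

Definition min_length_in (O : set ext_weyl) (x : ext_weyl) : Prop :=
  O x /\ forall y, O y -> (len x <= len y)%N.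

Definition hat (X : set ext_weyl) : set ext_weyl :=
  X `|` [set (tau * x * tau^-1) * tau ^+ 2 | x in X]
    `|` [set (tau ^+ 2 * x * tau ^- 2) * tau | x in X].

Definition O1 : set ext_weyl :=
  hat [set x | exists a b : int, x = tQ a b * s1 \/ x = tQ a b * s2].

(* uphalf m = floor ((m + 1) / 2); for m > 0, hat (Xeven m) is a
   delta-conjugacy class, with minimal length 2m. *)
Definition Xeven (m : nat) : set ext_weyl :=
  [set x | exists k : int,
     x \in [:: tQ (k - m./2%:Z) (2 * k + (odd m)%:Z) * (s2 * s1);
               tQ (k + (uphalf m)%:Z) (2 * k + (odd m)%:Z) * (s2 * s1);
               tQ (2 * k + (odd m)%:Z) (k + (uphalf m)%:Z) * (s1 * s2);
               tQ (2 * k + (odd m)%:Z) (k - m./2%:Z) * (s1 * s2);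
               tQ k (m%:Z - k);
               tQ (k - m%:Z) (- k)]].

Definition Oeven (m : nat) : set ext_weyl := hat (Xeven m).

Local Open Scope ring_scope.

(* (H, T) is the Iwahori-Hecke algebra of W~, unique up to isomorphism, and dH
   the action of delta on it; T 1 = 1 follows from hecke_span and hecke_mul. *)
Record is_hecke (H : algType laurent) (T : ext_weyl -> H)
    (dH : {linear H -> H}) : Prop := IsHecke {
  hecke_free : forall (r : seq ext_weyl) (c : ext_weyl -> laurent),
    uniq r -> \sum_(x <- r) c x *: T x = 0 -> {in r, forall x, c x = 0};
  hecke_span : forall h : H, exists (r : seq ext_weyl)
    (c : ext_weyl -> laurent), h = \sum_(x <- r) c x *: T x;
  hecke_mul : forall x y : ext_weyl,
    (len x + len y)%N = len (x * y)%g -> T x * T y = T (x * y)%g;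
  hecke_quad : forall i : 'I_3,
    (T (simple i) - vv%:A) * (T (simple i) + vvV%:A) = 0;
  hecke_delta : forall x : ext_weyl, dH (T x) = T (delta x) }.

Definition dcomm (H : algType laurent) (dH : {linear H -> H}) : set H :=
  [set h | exists r : seq (laurent * (H * H)),
     h = \sum_(p <- r) p.1 *: (p.2.1 * p.2.2 - p.2.2 * dH p.2.1)].

(* f is the (finitely supported) family of class polynomials of x, indexed by
   the delta-conjugacy classes O, rep O being a minimal length element of O
   (so that T_O is the class of T (rep O) modulo [H, H]_delta). *)
Definition class_polynomials (H : algType laurent) (T : ext_weyl -> H)
    (dH : {linear H -> H}) (rep : set ext_weyl -> ext_weyl) (x : ext_weyl)
    (f : set ext_weyl -> laurent) : Prop :=
  finite_set [set O | dclasses O /\ f O != 0] /\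
  dcomm dH (T x - \sum_(O \in dclasses) f O *: T (rep O)).

(* Main.v *)
(* For every function chi on the set of delta-conjugacy classes we write down a
   linear form phi on the Hecke algebra with phi (h h') = phi (h' delta(h)) and
   phi (T_x) = chi O for x of minimal length in O.  It vanishes on the twisted
   commutators, so taking for chi the indicator function of O and evaluating
   phi at T_w gives f_{w,O}.  Put u = v - v^-1.  By the reduction
   T_x == T_{s x delta(s)} + u T_{s x} for s x delta(s) of length len x - 2,
   the values of phi have to be
     Theta n = chi O_1 + u (chi O_2 + chi O_4 + ... + chi O_{2n})
       on the elements of O_1 of length 2n + 1, and
     Phi m n = chi O_{2m} + u (Theta m + ... + Theta (n - 1))
       on the elements of O_{2m} of length 2n.
   On the remaining elements t^lambda s_1 s_2 s_1 the value also depends on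
   lambda: conjugation acts on lambda by the affine Weyl group of the triangle
   <lambda, alpha_i> >= 0, <lambda, alpha_1 + alpha_2> <= 2, and phi is obtained
   by folding lambda into this triangle, adding some u (Phi m n) at each wall.
   The result does not depend on the folding because Phi m (n + 2) - Phi m n
   does not depend on m.  The trace property only has to be checked on the
   generators s_1 and tau. *)
Require Import Defs.
From HB Require Import structures.
From mathcomp Require Import all_boot all_order all_fingroup all_algebra.
From mathcomp Require Import mathcomp_extra boolp classical_sets functions.
From mathcomp Require Import cardinality fsbigop.
From mathcomp Require Import zify ring.

Set Implicit Arguments.
Unset Strict Implicit.
Unset Printing Implicit Defensive.

Import GRing.Theory.
Local Open Scope ring_scope.
Local Open Scope group_scope.

(** * Coordinates and multiplication in the extended affine Weyl group *)

(* The elements of W, by reduced words; K0 is the longest element. *)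
Inductive kind := Ke | K1 | K2 | K12 | K21 | K0.

Definition kperm (k : kind) : 'S_3 :=
  match k with
  | Ke => 1
  | K1 => tperm i0 i1
  | K2 => tperm i1 i2
  | K12 => tperm i0 i1 * tperm i1 i2
  | K21 => tperm i1 i2 * tperm i0 i1
  | K0 => tperm i0 i1 * tperm i1 i2 * tperm i0 i1
  end.

Definition kind_of (w : 'S_3) : kind :=
  match val (w i0), val (w i1) with
  | 0, 1 => Ke
  | 1, 0 => K1
  | 0, 2 => K2
  | 2, 0 => K12
  | 1, 2 => K21
  | _, _ => K0
  end%N.

Lemma kpermK : cancel kperm kind_of.
Proof. by case; rewrite /kind_of /kperm ?permM ?perm1 ?tperm3E. Qed.

Lemma kind_ofK : cancel kind_of kperm.
Proof.
move=> w; have neq : w i0 != w i1 by apply/eqP => /perm_inj.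
apply: perm3P; rewrite /kind_of; move: neq;
case: (ord3P (w i0)) => ->; case: (ord3P (w i1)) => -> //= _;
by rewrite ?permM ?perm1 ?tperm3E.
Qed.

Definition elt (p q : int) (k : kind) : ext_weyl := ExtWeyl (p, q) (kperm k).

Variant elt_spec : ext_weyl -> Prop := EltSpec p q k : elt_spec (elt p q k).

Lemma eltP x : elt_spec x.
Proof. by case: x => [[p q] w]; rewrite -(kind_ofK w); constructor. Qed.

Definition mul1k k :=
  match k with
  | Ke => K1 | K1 => Ke | K2 => K12 | K12 => K2 | K21 => K0 | K0 => K21
  end.

Definition mul2k k :=
  match k with
  | Ke => K2 | K1 => K21 | K2 => Ke | K12 => K0 | K21 => K1 | K0 => K12
  end.

Definition mul0k k :=
  match k with
  | Ke => K0 | K1 => K12 | K2 => K21 | K12 => K1 | K21 => K2 | K0 => Ke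
  end.

Definition mulck k :=
  match k with
  | Ke => K12 | K1 => K0 | K2 => K1 | K12 => K21 | K21 => Ke | K0 => K2
  end.

Definition mulk2 k :=
  match k with
  | Ke => K2 | K1 => K12 | K2 => Ke | K12 => K1 | K21 => K0 | K0 => K21
  end.

Definition mulkc k :=
  match k with
  | Ke => K12 | K1 => K2 | K2 => K0 | K12 => K21 | K21 => Ke | K0 => K1
  end.

Definition swapk k :=
  match k with
  | Ke => Ke | K1 => K2 | K2 => K1 | K12 => K21 | K21 => K12 | K0 => K0
  end.

Lemma eltE l w p q k : l = (p, q) -> w = kperm k -> ExtWeyl l w = elt p q k.
Proof. by move=> -> ->. Qed.

Lemma addcE (a b c d : int) : ((a, b) : coweight) + (c, d) = (a + c, b + d) :> coweight.
Proof. by []. Qed.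

Ltac perm3_compute := by apply: perm3P; rewrite ?(permM, wconjE, perm1) ?tperm3E.

Ltac elt_compute :=
  apply: eltE; [rewrite ?raddf0 ?wactM ?wact1 ?(wact_s1, wact_s2) ?addcE /=;
    congr pair; ring | perm3_compute].

Lemma s1_elt p q k : s1 * elt p q k = elt (- p)%R (p + q)%R (mul1k k).
Proof. by rewrite mulE; case: k; elt_compute. Qed.

Lemma s2_elt p q k : s2 * elt p q k = elt (p + q)%R (- q)%R (mul2k k).
Proof. by rewrite mulE; case: k; elt_compute. Qed.

Lemma s0_elt p q k : s0 * elt p q k = elt (1 - q)%R (1 - p)%R (mul0k k).
Proof. by rewrite s0E -s1s2s1E mulE; case: k; elt_compute. Qed.

Lemma tau_elt p q k : tau * elt p q k = elt (1 - p - q)%R p (mulck k).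
Proof. by rewrite tauE mulE; case: k; elt_compute. Qed.

Lemma elt_s2 p q k : elt p q k * s2 = elt p q (mulk2 k).
Proof. by rewrite mulE; case: k; elt_compute. Qed.

Lemma elt_tau p q k : elt p q k * tau =
  match k with
  | Ke | K2 => elt (p + 1) q (mulkc k)
  | K1 | K12 => elt (p - 1) (q + 1) (mulkc k)
  | _ => elt p (q - 1) (mulkc k)
  end%R.
Proof. by rewrite tauE mulE; case: k; elt_compute. Qed.

Lemma delta_elt p q k : delta (elt p q k) = elt q p (swapk k).
Proof. by rewrite /delta /=; congr ExtWeyl; case: k => /=; perm3_compute. Qed.

(** * The length function *)

(** The Iwahori-Matsumoto formula for t^(p, q) w: one term per positive root alpha, with [- 1] when
    w^-1 alpha is negative. *)
Definition elt_length (p q : int) (k : kind) : nat :=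
  match k with
  | Ke => absz p + absz q + absz (p + q)%R
  | K1 => absz (p - 1)%R + absz q + absz (p + q)%R
  | K2 => absz p + absz (q - 1)%R + absz (p + q)%R
  | K12 => absz (p - 1)%R + absz q + absz (p + q - 1)%R
  | K21 => absz p + absz (q - 1)%R + absz (p + q - 1)%R
  | K0 => absz (p - 1)%R + absz (q - 1)%R + absz (p + q - 1)%R
  end%N.

Definition explicit_length (x : ext_weyl) : nat :=
  elt_length (tpart x).1 (tpart x).2 (kind_of (wpart x)).

Lemma explicit_length_elt p q k : explicit_length (elt p q k) = elt_length p q k.
Proof. by rewrite /explicit_length kpermK. Qed.

Lemma explicit_length_simple i x :
  (explicit_length (simple i * x)%g <= (explicit_length x).+1)%N.
Proof.
case: (eltP x) => p q k.
by case: (ord3P i) => ->; rewrite /= ?s0_elt ?s1_elt ?s2_elt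
  !explicit_length_elt; case: k => /=; lia.
Qed.

Lemma explicit_length_descent x : (0 < explicit_length x)%N ->
  exists i, explicit_length x = (explicit_length (simple i * x)).+1.
Proof.
case: (eltP x) => p q k; rewrite explicit_length_elt => l_gt0.
have [] : [\/ elt_length p q k = (elt_length (1 - q) (1 - p) (mul0k k)).+1,
  elt_length p q k = (elt_length (- p) (p + q) (mul1k k)).+1 |
  elt_length p q k = (elt_length (p + q) (- q) (mul2k k)).+1].
  suff : elt_length p q k = (elt_length (1 - q) (1 - p) (mul0k k)).+1 \/
    elt_length p q k = (elt_length (- p) (p + q) (mul1k k)).+1 \/
    elt_length p q k = (elt_length (p + q) (- q) (mul2k k)).+1.
    by case=> [|[]]; [constructor 1 | constructor 2 | constructor 3].
  by move: l_gt0; case: k => /=; lia.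
- by exists i0; rewrite /= s0_elt explicit_length_elt.
- by exists i1; rewrite /= s1_elt explicit_length_elt.
- by exists i2; rewrite /= s2_elt explicit_length_elt.
Qed.

Lemma explicit_length_s1 x : explicit_length (s1 * x) = (explicit_length x).+1 \/
  explicit_length x = (explicit_length (s1 * x)).+1.
Proof.
case: (eltP x) => p q k; rewrite s1_elt !explicit_length_elt.
by case: k => /=; lia.
Qed.

Lemma explicit_length_s2 x : explicit_length (x * s2) = (explicit_length x).+1 \/
  explicit_length x = (explicit_length (x * s2)).+1.
Proof.
case: (eltP x) => p q k; rewrite elt_s2 !explicit_length_elt.
by case: k => /=; lia.
Qed.

Lemma explicit_length_taul x : explicit_length (tau * x) = explicit_length x.
Proof.
case: (eltP x) => p q k; rewrite tau_elt !explicit_length_elt.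
by case: k => /=; lia.
Qed.

Lemma explicit_length_taur x : explicit_length (x * tau) = explicit_length x.
Proof.
case: (eltP x) => p q k; rewrite elt_tau.
by case: k; rewrite !explicit_length_elt /=; lia.
Qed.

Lemma explicit_length_delta x : explicit_length (delta x) = explicit_length x.
Proof.
case: (eltP x) => p q k; rewrite delta_elt !explicit_length_elt.
by case: k => /=; lia.
Qed.

Lemma elt1 : 1 = elt 0 0 Ke.
Proof. by []. Qed.

Lemma s1E : s1 = elt 0 0 K1.
Proof. by []. Qed.

Lemma s2E : s2 = elt 0 0 K2.
Proof. by []. Qed.

Lemma elt_tauE : tau = elt 1 0 K12.
Proof. by rewrite -[LHS]mulg1 elt1 tau_elt; congr elt. Qed.

Lemma elt_tau2 : tau ^+ 2 = elt 0 1 K21.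
Proof. by rewrite expgS expg1 {2}elt_tauE tau_elt; congr elt. Qed.

Lemma explicit_length0 x : explicit_length x = 0%N -> exists j, x = tau ^+ j.
Proof.
case: (eltP x) => p q k; rewrite explicit_length_elt.
case: k => /= l0.
- exists 0%N; rewrite expg0 elt1; congr elt; lia.
- lia.
- lia.
- exists 1%N; rewrite expg1 elt_tauE; congr elt; lia.
- exists 2%N; rewrite elt_tau2; congr elt; lia.
- lia.
Qed.

Lemma simpleK i : simple i * simple i = 1.
Proof.
by case: (ord3P i) => ->; rewrite /= ?[X in _ * X]s0E -?s1s2s1E;
  rewrite ?[X in _ * X]s1E ?[X in _ * X]s2E -/(elt 1 1 K0) ?s0_elt ?s1_elt ?s2_elt elt1.
Qed.

(** A letter raises the explicit length by at most one, which bounds every word from below;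
    following descents down to a power of [tau] gives a word of exactly that size. *)
Lemma lenE x : len x = explicit_length x.
Proof.
have le_word y n : has_word y n -> (explicit_length y <= n)%N.
  case=> r [j [<- ->]]; elim: r => [|i r IHr] /=.
    rewrite big_nil mul1g; elim: j => [|j IHj].
      by rewrite expg0 elt1 explicit_length_elt.
    by rewrite expgS explicit_length_taul.
  rewrite big_cons -mulgA; apply: leq_trans (explicit_length_simple _ _) _.
  by rewrite ltnS.
have word n y : explicit_length y = n -> has_word y n.
  elim: n y => [|n IHn] y.
    by move/explicit_length0 => [j ->]; exists [::], j; rewrite big_nil mul1g.
  move=> ly; have [|i] := @explicit_length_descent y; first by rewrite ly.
  rewrite ly => -[/esym/IHn [r [j [sr yE]]]].
  exists (i :: r), j; split; first by rewrite /= sr.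
  by rewrite big_cons -mulgA -yE mulgA simpleK mul1g.
have [m_word m_min] : has_word x (len x) /\ forall k, has_word x k -> (len x <= k)%N.
  rewrite /len; case: xgetP => [n _ //|] /(_ (explicit_length x)) [].
  by split; [exact: word | exact: le_word].
by apply/eqP; rewrite eqn_leq le_word // m_min //; apply: word.
Qed.

Lemma simple_tau i : exists j, simple i = tau ^+ j * s1 * tau ^- j.
Proof.
case: (ord3P i) => ->.
- exists 2%N; rewrite -[LHS]/s0 -tau_s2 -tau_s1; move: tau s1 => t s.
  by rewrite (expgS t 1) expg1 invMg !mulgA.
- by exists 0%N; rewrite expg0 invg1 mul1g mulg1.
- by exists 1%N; rewrite expg1 tau_s1.
Qed.

Lemma len_taul x : len (tau * x) = len x.
Proof. by rewrite !lenE explicit_length_taul. Qed.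

Lemma len_taur x : len (x * tau) = len x.
Proof. by rewrite !lenE explicit_length_taur. Qed.

Lemma len_s1 x : len (s1 * x) = (len x).+1 \/ len x = (len (s1 * x)).+1.
Proof. by rewrite !lenE; exact: explicit_length_s1. Qed.

Lemma len_s2 x : len (x * s2) = (len x).+1 \/ len x = (len (x * s2)).+1.
Proof. by rewrite !lenE; exact: explicit_length_s2. Qed.

Lemma len_delta x : len (delta x) = len x.
Proof. by rewrite !lenE explicit_length_delta. Qed.

(** Each simple reflection is some tau^j s_1 tau^-j, so a descent of x gives x = tau^j s_1 (s_1
    tau^-j x) with a shorter last factor. Checks on generators thereby reduce to s_1 and [tau]. *)
Lemma ext_weyl_ind (P : ext_weyl -> Prop) :
    P 1 -> (forall x, P x -> P (tau * x)) ->
    (forall x, len (s1 * x) = (len x).+1 -> P x -> P (s1 * x)) ->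
  forall x, P x.
Proof.
move=> P1 Ptau Ps1.
have Ptauj j x : P x -> P (tau ^+ j * x).
  by elim: j => [|j IHj] Px; rewrite ?expg0 ?mul1g // expgS -mulgA; apply/Ptau/IHj.
have len_tauj j x : len (tau ^+ j * x) = len x.
  by elim: j => [|j IHj]; rewrite ?expg0 ?mul1g // expgS -mulgA len_taul.
have tauV j : tau ^- j = tau ^+ (2 * j).
  apply: (mulIg (tau ^+ j)); rewrite mulVg -expgD -[X in (_ + X)%N]mul1n.
  by rewrite -mulnDl expgM tau3 expg1n.
move=> x; have [n lx] : exists n, len x = n by exists (len x).
elim: n x lx => [|n IHn] x lx.
  move: lx; rewrite lenE => /explicit_length0 [j ->].
  by rewrite -[_ ^+ _]mulg1; apply: Ptauj.
have [|i] := @explicit_length_descent x; first by rewrite -lenE lx.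
rewrite -!lenE lx; have [j ->] := simple_tau i; set y := tau ^- j * x.
rewrite -!mulgA -/y len_tauj => -[ly].
have xE : x = tau ^+ j * (s1 * (s1 * y)).
  by rewrite [s1 * _]mulgA (simpleK i1) mul1g mulgA mulgV mul1g.
rewrite xE; apply: Ptauj; apply: Ps1; last exact: IHn.
by rewrite mulgA (simpleK i1) mul1g -ly -lx /y tauV len_tauj.
Qed.

(** * Conjugacy invariants and values of the trace form *)

(* CE m stands for O_{2m} (with O_0 the class of 1), C1 for O_1, and Cs, Cw for
   the classes of s_0 and of s_1 s_2 s_1. *)
Inductive cl := CE of nat | C1 | Cs | Cw.

(** For s_1 s_2 s_1, delta-conjugation by translations moves lambda by 2P, and the other
    conjugations permute the three nonzero residues modulo 2P transitively: hence the parity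
    test. *)
Definition elt_class (p q : int) (k : kind) : cl :=
  match k with
  | Ke => CE (absz (p + q)%R)
  | K21 => CE (absz p)
  | K12 => CE (absz q)
  | K1 | K2 => C1
  | K0 => if odd (absz p) || odd (absz q) then Cs else Cw
  end.

Section TraceValues.
Local Open Scope ring_scope.
Variables (R : comPzRingType) (u : R) (chi : cl -> R).

(** This is Theta n, and [even_val m n] is Phi m n. *)
Definition odd_val (n : nat) : R :=
  chi C1 + u * \sum_(1 <= i < n.+1) chi (CE i).

Definition even_val (m n : nat) : R :=
  chi (CE m) + u * \sum_(m <= i < n) odd_val i.

Lemma odd_valS n : odd_val n.+1 = odd_val n + u * chi (CE n.+1).
Proof. by rewrite /odd_val big_nat_recr //= mulrDr addrA. Qed.

Lemma even_valS m n : (m <= n)%N ->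
  even_val m n.+1 = even_val m n + u * odd_val n.
Proof. by move=> le_mn; rewrite /even_val big_nat_recr //= mulrDr addrA. Qed.

Lemma even_val_min m : even_val m m = chi (CE m).
Proof. by rewrite /even_val big_geq // mulr0 addr0. Qed.

(* t^(p, q) s_1 s_2 s_1 has odd length, so the rounded half is the second index
   of the value taken on O_{2|a|} in length one less. *)
Definition wall_val (a p q : int) : R :=
  u * even_val (absz a) (elt_length p q K0)./2.

(** The tests are the three walls of the triangle. If s is the simple reflection of the wall
    crossed, s t^(p, q) s_1 s_2 s_1 lies in O_{2|a|}, where a is the first argument of
    [wall_val]. *)
Definition fold_step (G : int -> int -> R) (p q : int) : R :=
  if p < 0 then G (- p) (p + q) + wall_val p p q
  else if q < 0 then G (p + q) (- q) + wall_val q p q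
  else if 2 < p + q then G (2 - q) (2 - p) + wall_val (2 - p - q) p q
  else chi (elt_class p q K0).

(* Each reflection shortens t^(p, q) s_1 s_2 s_1 by 2, so its length is enough
   fuel. *)
Fixpoint fold_val_rec (n : nat) : int -> int -> R :=
  if n is n'.+1 then fold_step (fold_val_rec n') else fun _ _ => 0.

Definition fold_val (p q : int) : R := fold_val_rec (elt_length p q K0) p q.

Lemma fold_val_rec_stable n n' p q :
  (elt_length p q K0 <= n)%N -> (elt_length p q K0 <= n')%N ->
  fold_val_rec n p q = fold_val_rec n' p q.
Proof.
elim: n n' p q => [|n IHn] [|n'] p q //=; try lia.
move=> le_n le_n'; rewrite /fold_step.
case: ifP => [p_lt0|/negbT p_ge0]; first by congr (_ + _); apply: IHn => /=; lia.
case: ifP => [q_lt0|/negbT q_ge0]; first by congr (_ + _); apply: IHn => /=; lia.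
by case: ifP => [c_lt0|//]; congr (_ + _); apply: IHn => /=; lia.
Qed.

Lemma fold_valE p q : fold_val p q = fold_step fold_val p q.
Proof.
have -> : fold_val p q = fold_val_rec (elt_length p q K0).+1 p q.
  by apply: fold_val_rec_stable.
rewrite /= /fold_step.
case: ifP => [p_lt0|/negbT p_ge0].
  by congr (_ + _); apply: fold_val_rec_stable => /=; lia.
case: ifP => [q_lt0|/negbT q_ge0].
  by congr (_ + _); apply: fold_val_rec_stable => /=; lia.
by case: ifP => [c_lt0|//]; congr (_ + _); apply: fold_val_rec_stable => /=; lia.
Qed.

(** Phi m (n + 2) - Phi m n = u (Theta n + Theta (n + 1)) does not involve m. *)
Lemma even_val_exchange m m' n : (m <= n)%N -> (m' <= n)%N ->
  even_val m n.+2 + even_val m' n = even_val m' n.+2 + even_val m n.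
Proof.
move=> le_m le_m'; rewrite !even_valS ?(leqW le_m) ?(leqW le_m') //.
by ring.
Qed.

Lemma wall_val_eq a b p q p' q' : absz a = absz b ->
  elt_length p q K0 = elt_length p' q' K0 -> wall_val a p q = wall_val b p' q'.
Proof. by rewrite /wall_val => -> ->. Qed.

(** The middle wall costs the same on both paths. The outer walls are crossed in opposite order at
    lengths differing by 4, so at second indices differing by 2, and [even_val_exchange] applies;
    its bounds come from [a] and [b] being nonzero. *)
Lemma wall_val_hexagon G a b c c' p q p1 q1 p1' q1' p2 q2 p2' q2' :
    ((absz a + absz b).+1 = (elt_length p q K0)./2)%N -> a != 0 -> b != 0 ->
    absz c = absz c' -> elt_length p1 q1 K0 = elt_length p1' q1' K0 ->
    elt_length p q K0 = (elt_length p2 q2 K0 + 4)%N ->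
    elt_length p q K0 = (elt_length p2' q2' K0 + 4)%N ->
  G + wall_val b p2 q2 + wall_val c p1 q1 + wall_val a p q =
  G + wall_val a p2' q2' + wall_val c' p1' q1' + wall_val b p q.
Proof.
move=> ab a0 b0 cc' l1 l2 l2'; rewrite (wall_val_eq cc' l1).
rewrite -!addrA; congr (_ + _); rewrite addrCA [RHS]addrCA; congr (_ + _).
rewrite addrC [RHS]addrC /wall_val -!mulrDr; congr (u * _).
have -> : (elt_length p2' q2' K0)./2 = (elt_length p2 q2 K0)./2 by congr (_./2); lia.
have -> : (elt_length p q K0)./2 = (elt_length p2 q2 K0)./2.+2 by rewrite l2; lia.
by apply: even_val_exchange; rewrite l2 in ab; lia.
Qed.

(** [fold_step] tests the walls in a fixed order; here the crossing relation is asked for at every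
    wall separating the point from the triangle. *)
Definition reflecting (p q : int) : Prop :=
  [/\ p < 0 -> fold_val p q = fold_val (- p) (p + q) + wall_val p p q,
      q < 0 -> fold_val p q = fold_val (p + q) (- q) + wall_val q p q &
      2 < p + q -> fold_val p q =
        fold_val (2 - q) (2 - p) + wall_val (2 - p - q) p q].

Lemma reflect1 p q p' q' : reflecting p q -> p < 0 -> p' = - p -> q' = p + q ->
  fold_val p q = fold_val p' q' + wall_val p p q.
Proof. by case=> Hp _ _ /Hp -> -> ->. Qed.

Lemma reflect2 p q p' q' : reflecting p q -> q < 0 -> p' = p + q -> q' = - q ->
  fold_val p q = fold_val p' q' + wall_val q p q.
Proof. by case=> _ Hq _ /Hq -> -> ->. Qed.

Lemma reflect0 p q p' q' : reflecting p q -> 2 < p + q ->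
  p' = 2 - q -> q' = 2 - p ->
  fold_val p q = fold_val p' q' + wall_val (2 - p - q) p q.
Proof. by case=> _ _ Hc /Hc -> -> ->. Qed.

(* Two walls separating a point from the fundamental triangle generate a
   dihedral group of order 6, and the two ways of crossing its three walls have
   the same total cost. *)
Lemma fold_val_reflect p q : reflecting p q.
Proof.
have [n le_n] : exists n, (elt_length p q K0 < n)%N by eexists; exact: ltnSn.
elim: n p q le_n => // n IHn p q le_n.
have IH p' q' : (elt_length p' q' K0 < elt_length p q K0)%N -> reflecting p' q'.
  by move=> lt; apply: IHn; apply: leq_trans lt _.
rewrite /reflecting [fold_val p q]fold_valE /fold_step.
case: ifP => [p_lt0|/negbT p_ge0].
  split=> // [q_lt0|c_lt0].
    (* Both paths lead to [(- q, - p)], the mirror image in the third wall p + q = 0 through the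
       origin. *)
    rewrite (@reflect1 (p + q) (- q) (- p - q) p); [| by apply: IH => /=; lia | lia..].
    rewrite (@reflect2 (- p - q) p (- q) (- p)); [| by apply: IH => /=; lia | lia..].
    rewrite (@reflect2 (- p) (p + q) q (- p - q)); [| by apply: IH => /=; lia | lia..].
    rewrite (@reflect1 q (- p - q) (- q) (- p)); [| by apply: IH => /=; lia | lia..].
    by apply: wall_val_hexagon => /=; lia.
  (* The walls meet at (0, 2); both paths lead to the mirror image in q = 2. *)
  rewrite (@reflect0 (- p) (p + q) (2 - p - q) (p + 2)); [| by apply: IH => /=; lia | lia..].
  rewrite (@reflect1 (2 - p - q) (p + 2) (p + q - 2) (4 - q)); [| by apply: IH => /=; lia | lia..].
  rewrite (@reflect1 (2 - q) (2 - p) (q - 2) (4 - p - q)); [| by apply: IH => /=; lia | lia..].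
  rewrite (@reflect0 (q - 2) (4 - p - q) (p + q - 2) (4 - q)); [| by apply: IH => /=; lia | lia..].
  rewrite (@wall_val_eq (2 - (q - 2) - (4 - p - q)) p (q - 2) (4 - p - q) (q - 2) (4 - p - q)) //; last lia.
  by apply: wall_val_hexagon => /=; lia.
case: ifP => [q_lt0|/negbT q_ge0]; split=> // c_lt0; last by rewrite c_lt0.
(* The walls meet at (2, 0); both paths lead to the mirror image in p = 2. *)
rewrite (@reflect0 (p + q) (- q) (q + 2) (2 - p - q)); [| by apply: IH => /=; lia | lia..].
rewrite (@reflect2 (q + 2) (2 - p - q) (4 - p) (p + q - 2)); [| by apply: IH => /=; lia | lia..].
rewrite (@reflect2 (2 - q) (2 - p) (4 - p - q) (p - 2)); [| by apply: IH => /=; lia | lia..].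
rewrite (@reflect0 (4 - p - q) (p - 2) (4 - p) (p + q - 2)); [| by apply: IH => /=; lia | lia..].
rewrite (@wall_val_eq (2 - (4 - p - q) - (p - 2)) q (4 - p - q) (p - 2) (4 - p - q) (p - 2)) //; last lia.
by apply: wall_val_hexagon => /=; lia.
Qed.

Lemma fold_val_reflect1 p q : p < 0 ->
  fold_val p q = fold_val (- p) (p + q) + wall_val p p q.
Proof. by case: (fold_val_reflect p q). Qed.

(** Delta-conjugation by [tau] acts here as a rotation of the triangle. It permutes the walls and
    keeps lengths, so folding a point and folding its image cost the same. *)
Lemma fold_val_rot p q : fold_val (2 - p - q) p = fold_val p q.
Proof.
have [n le_n] : exists n, (elt_length p q K0 < n)%N by eexists; exact: ltnSn.
elim: n p q le_n => // n IHn p q le_n.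
have [p_lt0|] := boolP (p < 0).
  rewrite (@reflect1 p q (- p) (p + q)) //; last exact: fold_val_reflect.
  rewrite (@reflect2 (2 - p - q) p (2 - q) (- p)); [| exact: fold_val_reflect | lia..].
  rewrite -(IHn (- p) (p + q)); last by move: le_n => /=; lia.
  by congr (fold_val _ _ + _); [lia | apply: wall_val_eq => /=; lia].
have [q_lt0 _|] := boolP (q < 0).
  rewrite (@reflect2 p q (p + q) (- q)) //; last exact: fold_val_reflect.
  rewrite (@reflect0 (2 - p - q) p (2 - p) (p + q)); [| exact: fold_val_reflect | lia..].
  rewrite -(IHn (p + q) (- q)); last by move: le_n => /=; lia.
  by congr (fold_val _ _ + _); [lia | apply: wall_val_eq => /=; lia].
have [c_lt0 _ _|] := boolP (2 < p + q).
  rewrite (@reflect0 p q (2 - q) (2 - p)) //; last exact: fold_val_reflect.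
  rewrite (@reflect1 (2 - p - q) p (p + q - 2) (2 - q)); [| exact: fold_val_reflect | lia..].
  rewrite -(IHn (2 - q) (2 - p)); last by move: le_n => /=; lia.
  by congr (fold_val _ _ + _); [lia | apply: wall_val_eq => /=; lia].
move=> /negbTE c_ge0 /negbTE q_ge0 /negbTE p_ge0; rewrite [LHS]fold_valE [RHS]fold_valE /fold_step.
rewrite p_ge0 q_ge0 c_ge0; do 2 (case: ifP => [|_]; first lia).
by congr chi => /=; congr (if _ then _ else _); lia.
Qed.
End TraceValues.

(** * Behaviour of the values under conjugation by generators *)

Definition elt_val (R : comPzRingType) (u : R) (chi : cl -> R)
    (p q : int) (k : kind) : R :=
  match k with
  | Ke => even_val u chi (absz (p + q)%R) (elt_length p q k)./2
  | K21 => even_val u chi (absz p) (elt_length p q k)./2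
  | K12 => even_val u chi (absz q) (elt_length p q k)./2
  | K1 | K2 => odd_val u chi (elt_length p q k)./2
  | K0 => fold_val u chi p q
  end.

Definition weyl_val (R : comPzRingType) (u : R) (chi : cl -> R) (x : ext_weyl) : R :=
  elt_val u chi (tpart x).1 (tpart x).2 (kind_of (wpart x)).

Definition weyl_class (x : ext_weyl) : cl :=
  elt_class (tpart x).1 (tpart x).2 (kind_of (wpart x)).

Lemma weyl_class_elt p q k : weyl_class (elt p q k) = elt_class p q k.
Proof. by rewrite /weyl_class kpermK. Qed.

Lemma len_elt p q k : len (elt p q k) = elt_length p q k.
Proof. by rewrite lenE explicit_length_elt. Qed.

Section WeylVal.
Variables (R : comPzRingType) (u : R) (chi : cl -> R).
Notation val := (weyl_val u chi).

Lemma weyl_val_elt p q k : val (elt p q k) = elt_val u chi p q k.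
Proof. by rewrite /weyl_val kpermK. Qed.

Lemma weyl_val_tau x : val (tau * x * tau) = val x.
Proof.
case: (eltP x) => p q k; rewrite tau_elt elt_tau.
case: k; rewrite !weyl_val_elt /=; try by congr (odd_val _ _ _./2); lia.
- by apply: (f_equal2 (even_val u chi)); lia.
- by apply: (f_equal2 (even_val u chi)); lia.
- by apply: (f_equal2 (even_val u chi)); lia.
- by rewrite -[RHS]fold_val_rot; congr fold_val; lia.
Qed.

Lemma weyl_val_s1s2 x : len (s1 * x * s2) = len x -> val (s1 * x * s2) = val x.
Proof.
case: (eltP x) => p q k; rewrite s1_elt elt_s2 !len_elt.
case: k; rewrite !weyl_val_elt /=; try by move=> ?; congr (odd_val _ _ _./2).
- by move=> ?; apply: (f_equal2 (even_val u chi)); lia.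
- by move=> ?; apply: (f_equal2 (even_val u chi)); lia.
- by move=> ?; apply: (f_equal2 (even_val u chi)); lia.
- by move=> ?; congr fold_val; lia.
Qed.

(** Serves when an element of O_1 grows from length 2n + 1 to 2n + 3: the element in between then
    has minimal length in O_{2n+2}. *)
Lemma odd_val_step n m n' i : m = n.+1 -> n' = n.+1 -> i = n.+1 ->
  odd_val u chi n' = (odd_val u chi n + u * even_val u chi m i)%R.
Proof. by move=> -> -> ->; rewrite odd_valS even_val_min. Qed.

Lemma even_val_step m m' n n' i : (m <= n)%N -> m' = m -> n' = n.+1 -> i = n ->
  even_val u chi m' n' = (even_val u chi m n + u * odd_val u chi i)%R.
Proof. by move=> le_mn -> -> ->; apply: even_valS. Qed.

(** The counterpart of the reduction relation for s = s_1, where delta(s_1) = s_2. *)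
Lemma weyl_val_s1s2_up x : len (s1 * x * s2) = (len x).+2 ->
  val (s1 * x * s2) = (val x + u * val (s1 * x)%g)%R.
Proof.
case: (eltP x) => p q k; rewrite s1_elt elt_s2 !len_elt.
case: k; rewrite !weyl_val_elt /= => l_up.
- by apply: even_val_step; lia.
- by apply: odd_val_step; lia.
- by apply: odd_val_step; lia.
- by apply: even_val_step; lia.
(* For s_2 s_1 the two lengths are equal, against [l_up]. *)
- lia.
rewrite fold_val_reflect1; last by lia.
congr (fold_val _ _ _ _ + u * even_val _ _ _ _)%R => /=; lia.
Qed.
End WeylVal.

(** * Classification of the delta-conjugacy classes *)

Lemma weyl_class_tau x : weyl_class (tau * x * tau) = weyl_class x.
Proof.
case: (eltP x) => p q k; rewrite tau_elt elt_tau.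
case: k; rewrite !weyl_class_elt //=; try by congr CE; lia.
by congr (if _ then _ else _); lia.
Qed.

Lemma weyl_class_s1s2 x : weyl_class (s1 * x * s2) = weyl_class x.
Proof.
case: (eltP x) => p q k; rewrite s1_elt elt_s2.
case: k; rewrite !weyl_class_elt //=; try by congr CE; lia.
by congr (if _ then _ else _); lia.
Qed.

Lemma s1V : s1^-1 = s1.
Proof. by apply: (mulIg s1); rewrite mulVg (simpleK i1). Qed.

Lemma s2V : s2^-1 = s2.
Proof. by apply: (mulIg s2); rewrite mulVg (simpleK i2). Qed.

Lemma dconj_trans x y z : dconj x y -> dconj y z -> dconj x z.
Proof.
by case=> a -> [b ->]; exists (b * a); rewrite delta_morph invMg !mulgA.
Qed.

Lemma dconj_sym x y : dconj x y -> dconj y x.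
Proof.
case=> a ->; exists a^-1; have : delta (a^-1 * a) = 1.
  by rewrite mulVg elt1 delta_elt.
rewrite delta_morph => /(canRL (mulgK _)); rewrite mul1g => ->.
by rewrite invgK !mulgA mulVg mul1g -mulgA mulVg mulg1.
Qed.

Lemma weyl_class_dconj x y : dconj x y -> weyl_class y = weyl_class x.
Proof.
case=> z ->; elim/ext_weyl_ind: z x => [|z IHz|z _ IHz] x.
- by rewrite mul1g (_ : delta 1 = 1) ?invg1 ?mulg1 // elt1 delta_elt.
- rewrite delta_morph invMg delta_tau invgK -(IHz x).
  by rewrite -[RHS]weyl_class_tau !mulgA.
- rewrite delta_morph invMg delta_s1 s2V -(IHz x).
  by rewrite -[RHS]weyl_class_s1s2 !mulgA.
Qed.

Lemma dconj_s1 x : dconj x (s1 * x * s2).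
Proof. by exists s1; rewrite delta_s1 s2V. Qed.

Lemma dconj_s2 x : dconj x (s2 * x * s1).
Proof. by exists s2; rewrite delta_s2 s1V. Qed.

Lemma elt_s1 p q k : elt p q k * s1 = elt p q (swapk (mulk2 (swapk k))).
Proof. by rewrite mulE; case: k; elt_compute. Qed.

(** Conjugation by t^mu, mu = (r, s), adds mu - w delta(mu) to the translation part; for the longest
    w, w delta is -1 and the shift is 2 mu. *)
Lemma dconj_transl p q k r s : dconj (elt p q k)
  match k with
  | Ke => elt (p + r - s) (q + s - r) k
  | K1 => elt (p + r + s) (q - r) k
  | K2 => elt (p - s) (q + r + s) k
  | K12 => elt (p + r *+ 2 + s) q k
  | K21 => elt p (q + r + s *+ 2) k
  | K0 => elt (p + r *+ 2) (q + s *+ 2) k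
  end%R.
Proof.
exists (elt r s Ke); rewrite delta_elt.
have -> : (elt s r Ke)^-1 = elt (- s)%R (- r)%R Ke.
  by apply: (mulIg (elt s r Ke)); rewrite mulVg mulE elt1; symmetry; elt_compute.
symmetry; case: k; rewrite /elt !mulE; elt_compute.
Qed.

Definition class_rep (c : cl) : ext_weyl :=
  match c with
  | CE m => elt m%:Z 0 Ke
  | C1 => s1
  | Cs => elt 1 1 K0
  | Cw => elt 0 0 K0
  end.

Definition class_min_len (c : cl) : nat :=
  match c with CE m => m.*2 | C1 | Cs => 1 | Cw => 3 end.

Lemma class_repK c : weyl_class (class_rep c) = c.
Proof.
by case: c => [m|||]; rewrite /class_rep ?s1E weyl_class_elt //=; congr CE; lia.
Qed.

Lemma len_class_rep c : len (class_rep c) = class_min_len c.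
Proof.
by case: c => [m|||]; rewrite /class_rep ?s1E len_elt //=; lia.
Qed.

Lemma dconj_eqr x y z : y = z -> dconj x y -> dconj x z.
Proof. by move=> ->. Qed.

Lemma dconj_CE p q : dconj (elt p q Ke) (class_rep (CE (absz (p + q)%R))).
Proof.
(* Translations can be moved along (1, -1), so only p + q matters. *)
have pos p' q' : (0 <= p' + q')%R ->
    dconj (elt p' q' Ke) (elt (absz (p' + q')%R) 0 Ke).
  move=> pq_ge0; apply: dconj_eqr (dconj_transl p' q' Ke q' 0%R).
  by congr elt; lia.
have [/pos //|pq_lt0] := boolP (0 <= p + q)%R.
(* Conjugating by s_1, s_2, s_1 in turn sends (p, q) to (- q, - p), which makes the sum positive. *)
apply: dconj_trans (dconj_s1 _) _; rewrite s1_elt elt_s2.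
apply: dconj_trans (dconj_s2 _) _; rewrite s2_elt elt_s1.
apply: dconj_trans (dconj_s1 _) _; rewrite s1_elt elt_s2 /=.
have -> : absz (p + q)%R = absz (- (- p + (p + q)) + (- p + (p + q) - (p + q)))%R by lia.
by apply: dconj_eqr (pos _ _ _); [congr elt; lia | lia].
Qed.

Lemma half_dec (z : int) : exists r : int, (z = r *+ 2 + (odd (absz z))%:Z)%R.
Proof. by exists (z %/ 2)%Z; lia. Qed.

Lemma dconj_class_rep x : dconj x (class_rep (weyl_class x)).
Proof.
case: (eltP x) => p q k; rewrite weyl_class_elt.
case: k => /=.
- exact: dconj_CE.
- apply: dconj_eqr (dconj_transl p q K1 q (- p - q)%R).
  by rewrite s1E; congr elt; lia.
- apply: dconj_trans (dconj_s1 _) _; rewrite s1_elt elt_s2 /=.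
  apply: dconj_eqr (dconj_transl (- p) (p + q) K1 (p + q) (- q)%R).
  by rewrite s1E; congr elt; lia.
- apply: dconj_trans (dconj_s1 _) _; rewrite s1_elt elt_s2 /=.
  by apply: dconj_eqr (dconj_CE _ _); congr (class_rep (CE _)); lia.
- apply: dconj_trans (dconj_s2 _) _; rewrite s2_elt elt_s1 /=.
  by apply: dconj_eqr (dconj_CE _ _); congr (class_rep (CE _)); lia.
(* Translations reduce lambda modulo 2P; conjugation by s_1 or s_2 first moves the residues (1, 0)
   and (0, 1) to (1, 1). *)
have [r pE] := half_dec p; have [s qE] := half_dec q.
move: pE qE; case: (odd (absz p)); case: (odd (absz q)) => /= pE qE.
- apply: dconj_eqr (dconj_transl p q K0 (- r)%R (- s)%R).
  by congr elt; lia.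
- apply: dconj_trans (dconj_s1 _) _; rewrite s1_elt elt_s2 /=.
  apply: dconj_eqr (dconj_transl _ _ K0 (r + 1)%R (- r - s)%R).
  by congr elt; lia.
- apply: dconj_trans (dconj_s2 _) _; rewrite s2_elt elt_s1 /=.
  apply: dconj_eqr (dconj_transl _ _ K0 (- r - s)%R (s + 1)%R).
  by congr elt; lia.
- apply: dconj_eqr (dconj_transl p q K0 (- r)%R (- s)%R).
  by congr elt; lia.
Qed.

Lemma dconjP x y : dconj x y <-> weyl_class y = weyl_class x.
Proof.
split=> [|xy]; first exact: weyl_class_dconj.
apply: dconj_trans (dconj_class_rep x) _; rewrite -xy.
exact/dconj_sym/dconj_class_rep.
Qed.

(** * The sets [O1] and [Oeven] as classes *)

Local Open Scope classical_set_scope.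

Definition class_set (c : cl) : set ext_weyl := [set x | weyl_class x = c].

Lemma dclassesP O : dclasses O <-> exists c, O = class_set c.
Proof.
split=> [[x ->]|[c ->]].
  by exists (weyl_class x); apply/seteqP; split=> y /= /dconjP.
exists (class_rep c); apply/seteqP; split=> y; rewrite /class_set /=.
  by move=> <-; apply/dconjP; rewrite class_repK.
by move=> /dconjP; rewrite class_repK.
Qed.

(** Since (tau x tau^-1) tau^2 = tau x tau and tau^3 = 1, [hat X] is the union of the tau^i X tau^i,
    the orbit of X under delta-conjugation by [tau]. *)
Lemma hatP X y : hat X y <-> [\/ X y, X (tau * y * tau) |
  X (tau ^+ 2 * y * tau ^+ 2)].
Proof.
have t3 : tau * (tau * tau) = 1 by rewrite -tau3 !expgS expg0 mulg1.
have tE (z : ext_weyl) : tau * (tau * (tau * z)) = z.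
  by rewrite mulgA [_ * (tau * z)]mulgA -[_ * tau]mulgA t3 mul1g.
have tV : tau^-1 = tau * tau by apply: (mulIg tau); rewrite mulVg -mulgA t3.
have t2 : tau ^+ 2 = tau * tau by rewrite (expgS tau 1) expg1.
rewrite /hat; move: tau t3 tE tV t2 => t t3 tE tV ->; split.
  case=> [[Xy|[x Xx <-]]|[x Xx <-]].
  - by constructor 1.
  - by constructor 3; rewrite tV -!mulgA !tE t3 mulg1.
  - by constructor 2; rewrite invMg tV -!mulgA !tE t3 mulg1.
case=> [Xy|Xy|Xy].
- by left; left.
- by right; exists (t * y * t) => //; rewrite invMg tV -!mulgA !tE t3 mulg1.
- by left; right; exists (t * t * y * (t * t)) => //; rewrite tV -!mulgA !tE t3 mulg1.
Qed.

Lemma coweight_mulrz (l : coweight) (c : int) : (l *~ c = (l.1 * c, l.2 * c))%R.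
Proof.
have mulrn n : (l *+ n = (l.1 * n%:Z, l.2 * n%:Z))%R.
  by elim: n => [|n IHn]; rewrite ?mulrS ?IHn /=; congr pair => /=; lia.
by case: c => n; rewrite ?NegzE ?mulrNz -pmulrn mulrn; congr pair => /=; lia.
Qed.

Lemma tQ_elt (a b : int) k :
  tQ a b * ExtWeyl 0%R (kperm k) = elt (a *+ 2 - b)%R (b *+ 2 - a)%R k.
Proof.
rewrite mulE raddf0 addr0 mul1g !coweight_mulrz.
by rewrite addcE; apply: eltE => //; congr pair => /=; lia.
Qed.

Lemma tQ_elt1 (a b : int) : tQ a b = elt (a *+ 2 - b)%R (b *+ 2 - a)%R Ke.
Proof. by rewrite -tQ_elt -[LHS]mulg1. Qed.

Lemma s1s2_kperm : s1 * s2 = ExtWeyl 0%R (kperm K12).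
Proof. by rewrite mulE raddf0 addr0. Qed.

Lemma s2s1_kperm : s2 * s1 = ExtWeyl 0%R (kperm K21).
Proof. by rewrite mulE raddf0 addr0. Qed.

(** Modulo 3 this is the coset of the translation part in P/Q, so it vanishes exactly on W_a. *)
Definition coset_index (x : ext_weyl) : int := ((tpart x).1 - (tpart x).2)%R.

(** Delta-conjugation by [tau] adds 2 to the index modulo 3, so every orbit of it meets W_a, and a
    class is recovered from its part in W_a. *)
Lemma hat_class (X : set ext_weyl) c :
    (forall x, X x <-> weyl_class x = c /\ (3 %| coset_index x)%Z) ->
  hat X = class_set c.
Proof.
move=> XP.
have idx x : weyl_class x = c ->
    (3 %| coset_index (tau * x * tau) - (coset_index x + 2))%Z.
  case: (eltP x) => p q k; rewrite tau_elt elt_tau weyl_class_elt.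
  by case: k => /=; rewrite /coset_index /=; lia.
have t2E x : tau ^+ 2 * x * tau ^+ 2 = tau * (tau * x * tau) * tau.
  by move: tau => t; rewrite (expgS t 1) expg1 !mulgA.
apply/seteqP; split=> y; rewrite /class_set /=.
  by move/hatP; case=> /XP [<- _] //; rewrite ?t2E !weyl_class_tau.
move=> yc; apply/hatP; have tyc : weyl_class (tau * y * tau) = c by rewrite weyl_class_tau.
move: (idx _ yc) (idx _ tyc); rewrite -t2E.
have [?|] := boolP (3 %| coset_index y)%Z; first by constructor 1; apply/XP.
have [?|] := boolP (3 %| coset_index (tau * y * tau))%Z.
  by constructor 2; apply/XP.
move=> ? ? ? ?; constructor 3; apply/XP; split; last by lia.
by rewrite t2E !weyl_class_tau.
Qed.

Lemma O1E : O1 = class_set C1.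
Proof.
apply: hat_class => x; split=> [[a [b []]] ->|].
- by rewrite (tQ_elt a b K1) weyl_class_elt /coset_index /=; split=> //; lia.
- by rewrite (tQ_elt a b K2) weyl_class_elt /coset_index /=; split=> //; lia.
case: (eltP x) => p q k; rewrite weyl_class_elt /coset_index /= => -[xc pq3].
exists ((p *+ 2 + q) %/ 3)%Z, ((p + q *+ 2) %/ 3)%Z.
case: k xc => //=.
- by left; rewrite (tQ_elt _ _ K1); congr elt; lia.
- by right; rewrite (tQ_elt _ _ K2); congr elt; lia.
- by case: ifP.
Qed.

Lemma OevenE m : Oeven m = class_set (CE m).
Proof.
apply: hat_class => x; split=> [[i]|].
  rewrite !inE => /orP[|/orP[|/orP[|/orP[|/orP[]]]]] /eqP ->;
    rewrite ?s2s1_kperm ?s1s2_kperm ?(tQ_elt _ _ K21) ?(tQ_elt _ _ K12) ?tQ_elt1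
      weyl_class_elt /coset_index /=; split; [congr CE| |congr CE| |congr CE| |
      congr CE| |congr CE| |congr CE|]; lia.
case: (eltP x) => p q k; rewrite weyl_class_elt /coset_index /= => -[xc pq3].
have mem6 (y a b c d e f : ext_weyl) : [\/ y = a, y = b, y = c | y = d] \/
    y = e \/ y = f -> y \in [:: a; b; c; d; e; f].
  by rewrite !inE => -[[]|[]] ->; rewrite eqxx ?orbT.
case: k xc => //= -[mE]; last by case: ifP mE.
- have [pq_ge0|pq_lt0] := boolP (0 <= p + q)%R.
    exists ((p *+ 2 + q) %/ 3)%Z; apply/mem6; right; left.
    by rewrite tQ_elt1; congr elt; lia.
  exists (- ((p + q *+ 2) %/ 3)%Z)%R; apply/mem6; right; right.
  by rewrite tQ_elt1; congr elt; lia.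
(* The coefficient of alpha_1 is 2k + [odd m], so halving it gives k; the sign of q selects the
   family. *)
- exists (((p *+ 2 + q) %/ 3)%Z %/ 2)%Z; apply/mem6; left.
  have [q_ge0|q_lt0] := boolP (0 <= q)%R.
    by constructor 3; rewrite s1s2_kperm (tQ_elt _ _ K12); congr elt; lia.
  by constructor 4; rewrite s1s2_kperm (tQ_elt _ _ K12); congr elt; lia.
- exists (((p + q *+ 2) %/ 3)%Z %/ 2)%Z; apply/mem6; left.
  have [p_ge0|p_lt0] := boolP (0 <= p)%R.
    by constructor 2; rewrite s2s1_kperm (tQ_elt _ _ K21); congr elt; lia.
  by constructor 1; rewrite s2s1_kperm (tQ_elt _ _ K21); congr elt; lia.
Qed.

(** Minimal length empties the sums in [odd_val] and [even_val], and for s_1 s_2 s_1 it places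
    lambda in the triangle, where folding stops. *)
Lemma weyl_val_min (R : comPzRingType) (u : R) (chi : cl -> R) x :
  len x = class_min_len (weyl_class x) ->
  weyl_val u chi x = chi (weyl_class x).
Proof.
case: (eltP x) => p q k; rewrite len_elt weyl_class_elt weyl_val_elt.
have odd0 n : n = 0%N -> odd_val u chi n = chi C1.
  by move=> ->; rewrite /odd_val big_geq // mulr0 addr0.
have even0 m n : n = m -> even_val u chi m n = chi (CE m).
  by move=> ->; exact: even_val_min.
case: k => /= l_min; try by [apply: odd0; lia | apply: even0; lia].
rewrite fold_valE /fold_step.
suff [p_ge0 q_ge0 c_ge0] : [/\ ~~ (p < 0), ~~ (q < 0) & ~~ (2 < p + q)]%R.
  by rewrite (negbTE p_ge0) (negbTE q_ge0) (negbTE c_ge0).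
by move: l_min; case: ifP => /= ? ?; split; lia.
Qed.

Lemma min_length_class_set c x : min_length_in (class_set c) x ->
  weyl_class x = c /\ len x = class_min_len c.
Proof.
case; rewrite /class_set /= => xc x_min; split=> //.
apply/eqP; rewrite eqn_leq -{1}len_class_rep x_min ?class_repK //=.
case: (eltP x) xc => p q k <-; rewrite len_elt weyl_class_elt.
by case: k => /=; try (case: ifP => /=); lia.
Qed.

Local Open Scope ring_scope.

(** * The twisted trace on the Hecke algebra *)

Section Hecke.
Variables (H : algType laurent) (T : ext_weyl -> H) (dH : {linear H -> H}).
Hypothesis hH : is_hecke T dH.

Let uu : laurent := vv - vvV.

(** Grouping the coefficients of equal elements extends freeness to lists with repetitions; this
    makes the form of [hecke_functional] independent of the chosen expansion. *)
Lemma hecke_comb0 (F : ext_weyl -> laurent) (s : seq (laurent * ext_weyl)) :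
  \sum_(p <- s) p.1 *: T p.2 = 0 -> \sum_(p <- s) p.1 * F p.2 = 0.
Proof.
pose r := undup [seq p.2 | p <- s].
have collect (V : lmodType laurent) (G : ext_weyl -> V) :
    \sum_(p <- s) p.1 *: G p.2 =
    \sum_(x <- r) (\sum_(p <- s | p.2 == x) p.1) *: G x.
  under [RHS]eq_bigr => x _ do rewrite scaler_suml.
  rewrite (exchange_big_dep xpredT) //= big_seq [RHS]big_seq.
  apply: eq_bigr => p ps; rewrite (eq_bigl (pred1 p.2)); last first.
    by move=> x; rewrite /= eq_sym.
  rewrite -big_filter filter_pred1_uniq ?undup_uniq ?big_seq1 //.
  by rewrite mem_undup map_f.
rewrite collect => /(hecke_free hH (undup_uniq _)) c0.
rewrite (collect laurent^o) big_seq big1 // => x /c0 ->.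
by rewrite scale0r.
Qed.

Lemma hecke_functional (F : ext_weyl -> laurent) :
  exists phi : {scalar H}, forall x, phi (T x) = F x.
Proof.
have span (h : H) : exists s : seq (laurent * ext_weyl),
    h = \sum_(p <- s) p.1 *: T p.2.
  have [r [c ->]] := hecke_span hH h.
  by exists [seq (c x, x) | x <- r]; rewrite big_map.
pose phi (h : H) : laurent := \sum_(p <- sval (cid (span h))) p.1 * F p.2.
have phiE s h : h = \sum_(p <- s) p.1 *: T p.2 ->
    phi h = \sum_(p <- s) p.1 * F p.2.
  move=> hE; rewrite /phi; case: (cid _) => s' /= hE'.
  apply/eqP; rewrite -subr_eq0; apply/eqP.
  have := @hecke_comb0 F (s' ++ [seq (- p.1, p.2) | p <- s]).
  rewrite !big_cat !big_map /=.
  under [X in _ + X = 0 -> _]eq_bigr do rewrite scaleNr.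
  under [X in (_ -> _ + X = 0) -> _]eq_bigr do rewrite mulNr.
  by rewrite !sumrN -hE -hE' subrr; apply.
have phi_lin : scalar phi.
  move=> a h h'.
  have [s hE] := span h; have [s' hE'] := span h'.
  rewrite (phiE _ _ hE) (phiE _ _ hE').
  rewrite (phiE ([seq (a * p.1, p.2) | p <- s] ++ s')).
    rewrite big_cat big_map /= mulr_sumr; congr (_ + _).
    by apply: eq_bigr => p _; rewrite mulrA.
  rewrite big_cat big_map /= -hE' {1}hE scaler_sumr; congr (_ + _).
  by apply: eq_bigr => p _; rewrite scalerA.
pose phiL : {scalar H} := HB.pack phi (GRing.isLinear.Build _ _ _ _ phi phi_lin).
exists phiL => x /=; rewrite (phiE [:: (1, x)]) big_seq1 /= ?mul1r //.
by rewrite scale1r.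
Qed.

Lemma hecke_sqr i : T (simple i) * T (simple i) = uu *: T (simple i) + 1.
Proof.
have := hecke_quad hH i.
rewrite mulrBl !mulrDr mulr_algr !mulr_algl scalerA mulvvV scale1r.
rewrite /uu scalerBl => E; apply/eqP; rewrite -subr_eq0 -[X in _ == X]E.
by rewrite !opprD opprK !addrA; apply/eqP; congr (_ - _); rewrite addrAC.
Qed.

Lemma mulT_s1 x : T s1 * T x =
  if (len (s1 * x)%g == (len x).+1)%N then T (s1 * x)%g
  else uu *: T x + T (s1 * x)%g.
Proof.
have ls1 : len s1 = 1%N by rewrite s1E len_elt.
case: eqP => [up|]; first by rewrite (hecke_mul hH) // up ls1.
case: (len_s1 x) => [//|down _]; set y := (s1 * x)%g.
have xE : x = (s1 * y)%g by rewrite /y mulgA (simpleK i1) mul1g.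
have TxE : T x = T s1 * T y by rewrite (hecke_mul hH) -?xE // down ls1.
by rewrite TxE mulrA (hecke_sqr i1) mulrDl mul1r -scalerAl.
Qed.

Lemma mulT_s2 x : T x * T s2 =
  if (len (x * s2)%g == (len x).+1)%N then T (x * s2)%g
  else uu *: T x + T (x * s2)%g.
Proof.
have ls2 : len s2 = 1%N by rewrite s2E len_elt.
case: eqP => [up|]; first by rewrite (hecke_mul hH) // up ls2 addn1.
case: (len_s2 x) => [//|down _]; set y := (x * s2)%g.
have xE : x = (y * s2)%g by rewrite /y -mulgA (simpleK i2) mulg1.
have TxE : T x = T y * T s2 by rewrite (hecke_mul hH) -?xE // down ls2 addn1.
by rewrite TxE -mulrA (hecke_sqr i2) mulrDr mulr1 -scalerAr.
Qed.

Lemma len_tau : len tau = 0%N.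
Proof. by rewrite elt_tauE len_elt. Qed.

Lemma len_tauV x : len (x * tau^-1)%g = len x.
Proof. by rewrite -[RHS](congr1 len (mulgKV tau x)) len_taur. Qed.

Lemma mulT_tau x : T tau * T x = T (tau * x)%g.
Proof. by rewrite (hecke_mul hH) // len_tau len_taul. Qed.

Lemma mulT_tauV x : T x * T tau^-1%g = T (x * tau^-1)%g.
Proof.
by rewrite (hecke_mul hH) // len_tauV -[tau^-1%g]mul1g len_tauV elt1 len_elt addn0.
Qed.

(** [k] stands for delta(h); as a separate argument it makes the condition stable under products of
    pairs. *)
Definition delta_trace_at (phi : H -> laurent) (h k : H) : Prop :=
  forall h', phi (h * h') = phi (h' * k).

Section Trace.
Variables (chi : cl -> laurent) (phi : {scalar H}).
Hypothesis phiE : forall x, phi (T x) = weyl_val uu chi x.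

Lemma delta_trace_basis h k :
  (forall x, phi (h * T x) = phi (T x * k)) -> delta_trace_at phi h k.
Proof.
move=> hk h'; have [r [c ->]] := hecke_span hH h'.
rewrite mulr_sumr mulr_suml !linear_sum; apply: eq_bigr => x _.
by rewrite -scalerAr -scalerAl !linearZ /= hk.
Qed.

(** This is phi (T_{s_1} T_x) = phi (T_x T_{s_2}), split by whether s_1 and s_2 lengthen x. *)
Lemma s1_val_s2 x :
  (if len (s1 * x)%g == (len x).+1 then weyl_val uu chi (s1 * x)%g
   else uu * weyl_val uu chi x + weyl_val uu chi (s1 * x)%g) =
  (if len (x * s2)%g == (len x).+1 then weyl_val uu chi (x * s2)%g
   else uu * weyl_val uu chi x + weyl_val uu chi (x * s2)%g).
Proof.
have E : (s1 * (x * s2) * s2 = s1 * x)%g by rewrite -!mulgA (simpleK i2) mulg1.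
have E' : (s1 * (s1 * x) * s2 = x * s2)%g by rewrite !mulgA (simpleK i1) mul1g.
case: eqP => l1; case: eqP => l2.
- by rewrite -E weyl_val_s1s2 // E l1 l2.
(* Here s_1 x is longer by two than x s_2, and the middle element s_1 x s_2 has the length of x. *)
- have {}l2 : len x = (len (x * s2)%g).+1 by case: (len_s2 x).
  rewrite -E weyl_val_s1s2_up ?E ?l1 -?l2 // addrC; congr (uu * _ + _).
  rewrite mulgA weyl_val_s1s2 //.
  have A : (s1 * (x * s2) = s1 * x * s2)%g by rewrite mulgA.
  by move: (len_s1 (x * s2)%g) (len_s2 (s1 * x)%g); rewrite A; lia.
- have {}l1 : len x = (len (s1 * x)%g).+1 by case: (len_s1 x).
  rewrite -E' weyl_val_s1s2_up ?E' ?l2 -?l1 // addrC.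
  by rewrite mulgA (simpleK i1) mul1g.
- congr (_ + _); rewrite -E weyl_val_s1s2 // E.
  by case: (len_s1 x) => [//|]; case: (len_s2 x) => [//|]; lia.
Qed.

Lemma delta_trace_s1 : delta_trace_at phi (T s1) (T s2).
Proof.
apply: delta_trace_basis => x; rewrite mulT_s1 mulT_s2.
by have := s1_val_s2 x; do 2 case: ifP => _; rewrite ?linearD ?linearZ /= !phiE.
Qed.

Lemma delta_trace_tau : delta_trace_at phi (T tau) (T tau^-1%g).
Proof.
apply: delta_trace_basis => x; rewrite mulT_tau mulT_tauV !phiE.
by rewrite -[RHS]weyl_val_tau (mulgA tau x) mulgVK.
Qed.

Lemma delta_traceM h1 k1 h2 k2 : delta_trace_at phi h1 k1 ->
  delta_trace_at phi h2 k2 -> delta_trace_at phi (h1 * h2) (k1 * k2).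
Proof. by move=> P1 P2 h'; rewrite -mulrA P1 -mulrA P2 mulrA. Qed.

Lemma hecke1 x : T 1%g * T x = T x /\ T x * T 1%g = T x.
Proof.
have l1 : len 1%g = 0%N by rewrite elt1 len_elt.
by split; rewrite (hecke_mul hH) ?mul1g ?mulg1 ?l1 // addn0.
Qed.

Lemma delta_trace_T x : delta_trace_at phi (T x) (T (delta x)).
Proof.
elim/ext_weyl_ind: x => [|x IHx|x up IHx].
- have -> : delta 1%g = 1%g by rewrite elt1 delta_elt.
  by apply: delta_trace_basis => y; have [-> ->] := hecke1 y.
- rewrite -mulT_tau delta_morph delta_tau -(hecke_mul hH); last first.
    have tV y : len (tau^-1 * y)%g = len y by rewrite -len_taul mulVKg.
    by rewrite tV -[tau^-1%g]mulg1 tV elt1 len_elt.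
  exact: delta_traceM delta_trace_tau IHx.
rewrite delta_morph delta_s1 -(hecke_mul hH (x := s2)); last first.
  by rewrite s2E len_elt -s2E -delta_s1 -delta_morph !len_delta up.
have -> : T (s1 * x)%g = T s1 * T x by rewrite mulT_s1 up eqxx.
exact: delta_traceM delta_trace_s1 IHx.
Qed.

Lemma delta_trace_dH h : delta_trace_at phi h (dH h).
Proof.
move=> h'; have [r [c ->]] := hecke_span hH h.
rewrite mulr_suml linear_sum [dH _]linear_sum mulr_sumr linear_sum.
apply: eq_bigr => x _; rewrite -scalerAl !linearZ /= -scalerAr linearZ /=.
by rewrite delta_trace_T (hecke_delta hH).
Qed.

Lemma dcomm_trace0 h : dcomm dH h -> phi h = 0.
Proof.
case=> r ->; rewrite linear_sum big1 // => p _.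
by rewrite linearZ /= linearB /= delta_trace_dH subrr mulr0.
Qed.
End Trace.

(** Applying phi for the indicator of c to the congruence kills the commutator and leaves only the
    coefficient at [class_set c]. *)
Lemma class_polynomials_val (rep : set ext_weyl -> ext_weyl) w f c :
    (forall O, dclasses O -> min_length_in O (rep O)) ->
    class_polynomials T dH rep w f ->
  f (class_set c) = weyl_val uu (fun d => (`[< d = c >])%:R) w.
Proof.
move=> hrep [f_fin fw]; set chi := fun d => _.
have [phi phiE] := hecke_functional (weyl_val uu chi).
have := dcomm_trace0 phiE fw; rewrite linearB /= phiE => /eqP.
rewrite subr_eq0 => /eqP ->; rewrite linear_sum /=.
pose F O := f O *: T (rep O).
have phiF d : phi (F (class_set d)) = f (class_set d) * (`[< d = c >])%:R.
  have /hrep/min_length_class_set[repc replen] : dclasses (class_set d).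
    by apply/dclassesP; exists d.
  by rewrite linearZ /= phiE weyl_val_min repc.
have suppE : finite_support 0 dclasses F =i
    (dclasses `&` F @^-1` [set~ 0])%classic.
  apply: in_finite_support; apply: sub_finite_set f_fin => O [classO].
  rewrite /preimage /= => F0; split=> //; apply/eqP => f0; apply: F0.
  by rewrite /F f0 scale0r.
have c_class : dclasses (class_set c) by apply/dclassesP; exists c.
have notc O : O \in finite_support 0 dclasses F -> O != class_set c ->
    phi (F O) = 0.
  rewrite suppE => /set_mem[/dclassesP[d ->] _] /eqP dc; rewrite phiF.
  by case: asboolP => [dE|]; [case: dc; rewrite dE | rewrite mulr0].
have phic : phi (F (class_set c)) = f (class_set c).
  by rewrite phiF (introT (asboolP _)) // mulr1.
have [c_supp|c_supp] := boolP (class_set c \in finite_support 0 dclasses F).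
  rewrite (bigD1_seq _ c_supp) ?finite_support_uniq //= -/(F _) phic.
  rewrite big_seq_cond big1 ?addr0 // => O /andP[]; exact: notc.
rewrite big_seq big1 => [|O O_supp]; last first.
  apply: (notc O O_supp); apply/eqP => Oc.
  by move: c_supp; rewrite -Oc O_supp.
(* A nonzero coefficient would put the class of c into the support, by [phic]. *)
apply/eqP; apply/negPn/negP => fc; case/negP: c_supp.
rewrite suppE; apply/mem_set; split=> //; rewrite /preimage /= => F0.
by move: fc; rewrite -phic F0 linear0 eqxx.
Qed.
End Hecke.

(** * Evaluation of the class polynomials *)

(** For the indicator of O_{2n}, n > 0, Theta i is u if n <= i and 0 otherwise, so the i from max(m,
    n) to m + k - 1 are counted; truncated subtraction covers n >= m + k. For O_1 every Theta i is
    1. *)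
Lemma sum_odd_val_indicator (u : laurent) (c : cl) m k :
  \sum_(m <= i < m + k) odd_val u (fun d => (`[< d = c >])%:R) i =
  match c with
  | C1 => k%:R
  | CE n => if n == 0%N then 0 else (m + k - maxn m n)%:R * u
  | _ => 0
  end.
Proof.
have oddE i : odd_val u (fun d => (`[< d = c >])%:R) i =
    match c with
    | C1 => 1
    | CE n => ((0 < n)%N && (n <= i)%N)%:R * u
    | _ => 0
    end.
  rewrite /odd_val; case: c => [n|||].
  - rewrite asboolF // add0r mulrC; congr (_ * u).
    elim: i => [|i IHi]; first by rewrite big_geq //; case: n.
    rewrite big_nat_recr //= IHi; case: asboolP => [[<-]|neq] /=.
      by rewrite ltnn leqnn add0r.
    have ni : n <> i.+1 by move=> E; case: neq; rewrite E.
    by rewrite addr0; congr (nat_of_bool _)%:R; lia.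
  - rewrite asboolT // big1 ?mulr0 ?addr0 // => i' _; by rewrite asboolF.
  - rewrite asboolF // big1 ?mulr0 ?addr0 // => i' _; by rewrite asboolF.
  - rewrite asboolF // big1 ?mulr0 ?addr0 // => i' _; by rewrite asboolF.
under eq_bigr do rewrite oddE.
case: c {oddE} => [n|||]; last by rewrite big1.
- rewrite -mulr_suml; case: eqP => [->|n0].
    by rewrite big1 ?mul0r.
  congr (_ * u); elim: k => [|k IHk].
    by rewrite addn0 big_geq // (_ : m - maxn m n = 0)%N //; lia.
  rewrite addnS big_nat_recr ?leq_addr //= IHk -natrD; congr _%:R.
  by lia.
- by rewrite sumr_const_nat addKn.
- by rewrite big1.
Qed.

Lemma weyl_val_CE (R : comPzRingType) (u : R) (chi : cl -> R) x m :
  weyl_class x = CE m -> weyl_val u chi x = even_val u chi m (len x)./2.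
Proof.
case: (eltP x) => p q k; rewrite weyl_class_elt weyl_val_elt len_elt.
by case: k => //= [[->]|[->]|[->]|] //; case: ifP.
Qed.

Local Open Scope classical_set_scope.
Local Open Scope ring_scope.

Theorem proposition2p46
    (H : algType laurent) (T : ext_weyl -> H) (dH : {linear H -> H})
    (hH : is_hecke T dH)
    (rep : set ext_weyl -> ext_weyl)
    (hrep : forall O, dclasses O -> min_length_in O (rep O))
    (m : nat) (hm : (0 < m)%N) (k : nat) (w : ext_weyl)
    (hw : Oeven m w) (hlen : len w = (2 * m + 2 * k)%N)
    (f : set ext_weyl -> laurent) (hf : class_polynomials T dH rep w f) :
  [/\ forall j, (1 <= j <= k.-1)%N ->
        f (Oeven (m + j)) = (k - j)%:R * (vv - vvV) ^+ 2,
      f (Oeven m) = k%:R * (vv - vvV) ^+ 2 + 1,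
      forall j, (1 <= j <= m.-1)%N ->
        f (Oeven (m - j)) = k%:R * (vv - vvV) ^+ 2,
      f O1 = k%:R * (vv - vvV) &
      forall O, dclasses O -> O <> Oeven m -> O <> O1 ->
        (forall j, (1 <= j <= k.-1)%N -> O <> Oeven (m + j)) ->
        (forall j, (1 <= j <= m.-1)%N -> O <> Oeven (m - j)) ->
        f O = 0].
Proof.
have wm : weyl_class w = CE m by move: hw; rewrite OevenE.
(* The value is Phi m (m + k) for the indicator of c. *)
have fE c : f (class_set c) = (`[< CE m = c >])%:R + (vv - vvV) *
    match c with
    | C1 => k%:R
    | CE n => if n == 0%N then 0 else (m + k - maxn m n)%:R * (vv - vvV)
    | _ => 0
    end.
  rewrite (class_polynomials_val hH c hrep hf) (weyl_val_CE _ _ wm) hlen.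
  rewrite (_ : (2 * m + 2 * k)./2 = m + k)%N; last by lia.
  by rewrite /even_val sum_odd_val_indicator.
have fCE n : n <> m -> (0 < n)%N ->
    f (Oeven n) = (m + k - maxn m n)%:R * (vv - vvV) ^+ 2.
  move=> nm n_gt0; rewrite OevenE fE asboolF; last by case=> mn; apply: nm.
  by rewrite add0r ifN; [rewrite expr2 mulrCA | lia].
split.
- move=> j j_bounds; rewrite fCE; [congr (_%:R * _) | |]; lia.
- rewrite OevenE fE asboolT // ifN; last by lia.
  by rewrite maxnn addKn expr2 mulrCA addrC.
- move=> j j_bounds; rewrite fCE; [congr (_%:R * _) | |]; lia.
- by rewrite O1E fE asboolF // add0r mulrC.
move=> O /dclassesP[c ->] neqm neq1 neqD neqB.
case: c neqm neq1 neqD neqB => [n|||] neqm neq1 neqD neqB; first last.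
- by rewrite fE asboolF // mulr0 addr0.
- by rewrite fE asboolF // mulr0 addr0.
- by rewrite O1E in neq1.
have nm : n <> m by move=> nm; apply: neqm; rewrite OevenE nm.
(* The class of 1 enters no Theta i, whose sum starts at index 1. *)
have [->|n_gt0] := posnP n.
  by rewrite fE asboolF ?eqxx ?mulr0 ?addr0 //; case; lia.
(* The excluded classes leave n >= m + k, where the truncated difference is 0. *)
rewrite -OevenE fCE // (_ : m + k - maxn m n = 0)%N ?mul0r //.
have [lt_nm|le_mn] := ltnP n m.
  case: (neqB (m - n)%N); first by lia.
  by rewrite -OevenE; congr Oeven; lia.
have [lt_nmk|le_mkn] := ltnP n (m + k); last by lia.
case: (neqD (n - m)%N); first by lia.
by rewrite -OevenE; congr Oeven; lia.
Qed.
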